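(* The class of box intersection graphs in $\mathbb{R}^3$ has unbounded functionality; that is, for every integer $k$ there exists a box intersection graph $G$ in $\mathbb{R}^3$ with $\mathrm{fun}(G)>k$.
   Context: All graphs are finite, undirected, without loops and multiple edges. A box in $\mathbb{R}^d$ is a solid $d$-dimensional rectangle with axis-parallel sides (a product of $d$ closed intervals). A graph $G$ is a box intersection graph in $\mathbb{R}^d$ if each vertex of $G$ can be associated with a box in $\mathbb{R}^d$ so that two distinct vertices of $G$ are adjacent if and only if the corresponding boxes intersect. Let $G$ be a graph with adjacency matrix $A$. A vertex $y\in V(G)$ is a function of vertices $x_1,\ldots,x_k\in V(G)\setminus\{y\}$ if there is a Boolean function $f$ of $k$ variables such that for every vertex $z\in V(G)$ different from $y,x_1,\ldots,x_k$ we have $A(y,z)=f(A(z,x_1),\ldots,A(z,x_k))$. The minimum $k$ (with $k=0$ allowed, in which case $f$ is a constant) such that $y$ is a function of $k$ other vertices is the functionality of $y$ in $G$, denoted $\mathrm{fun}_G(y)$. The functionality of $G$ is $$\mathrm{fun}(G)=\max_H\min_{y\in V(H)}\mathrm{fun}_H(y),$$ where the maximum is over all (nonempty) induced subgraphs $H$ of $G$. *)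

(* Defs.v *)
From HB Require Import structures.
From mathcomp Require Import all_boot all_order all_algebra.
From mathcomp Require Import classical_sets reals.
Set Implicit Arguments.
Unset Strict Implicit.
Unset Printing Implicit Defensive.
Import Order.TTheory GRing.Theory Num.Theory.

Record sgraph := SGraph {
  vertex :> finType;
  adj : rel vertex;
  adj_sym : symmetric adj;
  adj_irrefl : irreflexive adj }.

Section Induced.
Variables (G : sgraph) (H : {set G}).

Definition induced_adj : rel {x : G | x \in H} :=
  fun u v => adj (val u) (val v).

Lemma induced_adj_sym : symmetric induced_adj.
Proof. by move=> u v; rewrite /induced_adj adj_sym. Qed.

Lemma induced_adj_irrefl : irreflexive induced_adj.
Proof. by move=> u; rewrite /induced_adj adj_irrefl. Qed.

Definition induced : sgraph := SGraph induced_adj_sym induced_adj_irrefl.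

End Induced.

Section Functionality.
Variable G : sgraph.

Definition is_function_of (y : G) (k : nat) (x : k.-tuple G) : bool :=
  (y \notin x) &&
  [exists f : {ffun k.-tuple bool -> bool},
    [forall z : G, (z != y) && (z \notin x) ==>
       (adj y z == f (map_tuple (adj z) x))]].

Definition function_of_some (y : G) (k : nat) : bool :=
  [exists x : k.-tuple G, is_function_of y x].

(* All the other vertices together vacuously determine y. *)
Lemma function_of_others (y : G) : function_of_some y #|G|.-1.
Proof.
have sz : size (enum (predC1 y)) == #|G|.-1 by rewrite -cardE cardC1.
apply/existsP; exists (Tuple sz); apply/andP; split.
  by rewrite memtE /= mem_enum inE eqxx.
apply/existsP; exists [ffun=> false]; apply/forallP => z.
by rewrite memtE /= mem_enum inE andbN.
Qed.

Lemma function_of_some_ex (y : G) : exists k, function_of_some y k.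
Proof. by exists #|G|.-1; exact: function_of_others. Qed.

Definition vertex_fun (y : G) : nat := ex_minn (function_of_some_ex y).

Lemma vertex_fun_lt (y : G) : vertex_fun y < #|G|.
Proof.
rewrite /vertex_fun; case: ex_minnP => m _ /(_ _ (function_of_others y)) le_m.
by rewrite (leq_ltn_trans le_m)// ltn_predL; apply/card_gt0P; exists y.
Qed.

(* By vertex_fun_lt the default #|G| is never the minimum unless G is empty. *)
Definition min_fun : nat := \big[minn/#|G|]_(y : G) vertex_fun y.

End Functionality.

Definition functionality (G : sgraph) : nat :=
  \max_(H : {set G} | H != finset.set0) min_fun (induced H).

Local Open Scope classical_set_scope.
Local Open Scope ring_scope.

(* A box is solid, hence the strict inequalities between the end points. *)
Definition is_box (R : realType) (d : nat) (B : set 'rV[R]_d) : Prop :=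
  exists a b : 'rV[R]_d, (forall i, a 0 i < b 0 i) /\
    B = [set x | forall i, x 0 i \in `[a 0 i, b 0 i]].

Definition box_graph (R : realType) (d : nat) (G : sgraph) : Prop :=
  exists2 B : G -> set 'rV[R]_d, (forall v, is_box (B v)) &
    forall u v : G, u != v -> adj u v <-> B u `&` B v !=set0.

(* Main.v *)
(** Take the points of [{0, ..., N-1}^N] and the axis-parallel lines through
    them, with incidence as adjacency. Two points lie on at most one common line
    and two lines share at most one point, while every degree is [N]; hence for
    [N = k + 2] any [k] vertices other than [y] miss both some neighbour and some
    non-neighbour of [y], so [y] is not a function of them. To draw this graph
    with boxes, read a point in base [N] from left to right and from right to
    left: fixing the digits on one side of position [j] confines one reading to an
    interval, so a line in direction [j] is exactly the set of points in a planar
    rectangle. In the third dimension the rectangles are put at different heights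
    and the points become tall columns. *)
Require Import Defs.
From mathcomp Require Import all_boot all_order all_algebra.
From mathcomp Require Import classical_sets reals.
From mathcomp Require Import zify.
Set Implicit Arguments.
Unset Strict Implicit.
Unset Printing Implicit Defensive.
Import Order.TTheory GRing.Theory Num.Theory.

(** * Base-[b] expansions and doubled integer intervals *)

Definition radix (b n : nat) (c : 'I_n -> nat) : nat := \sum_(i < n) c i * b ^ i.

Lemma radix_recl (b n : nat) (c : 'I_n.+1 -> nat) :
  radix b c = radix b (fun i => c (lift ord0 i)) * b + c ord0.
Proof.
rewrite /radix big_ord_recl expn0 muln1 addnC big_distrl /=; congr (_ + _).
by apply: eq_bigr => i _; rewrite /bump leq0n add1n expnSr mulnA.
Qed.

(** Digit 0 is the least significant, so dividing by [b ^ j] forgets just the digits below [j]. The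
    induction peels off digit 0, lowering [j] as well when it is positive. *)
Lemma radix_div_eq (b n j : nat) (c a : 'I_n -> nat) :
  (forall i, c i < b) -> (forall i, a i < b) ->
  radix b c %/ b ^ j = radix b a %/ b ^ j <-> forall i : 'I_n, j <= i -> c i = a i.
Proof.
elim: n j c a => [|n IH] j c a cb ab.
  by split=> [_ []//|_]; rewrite /radix !big_ord0.
have b_gt0 : 0 < b by apply: leq_ltn_trans (cb ord0).
have divb (e : 'I_n.+1 -> nat) : (forall i, e i < b) ->
    radix b e %/ b = radix b (fun i => e (lift ord0 i)).
  by move=> eb; rewrite radix_recl divnMDl// divn_small ?addn0.
have modb (e : 'I_n.+1 -> nat) : (forall i, e i < b) -> radix b e %% b = e ord0.
  by move=> eb; rewrite radix_recl modnMDl modn_small.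
case: j => [|j].
  rewrite expn0 !divn1; split=> [eq_ca i _|eq_ca].
    have [k ->|->] := unliftP ord0 i; last by rewrite -modb// eq_ca modb.
    apply: (IH 0 (fun i => c (lift ord0 i)) (fun i => a (lift ord0 i)) _ _).1 => //.
    by rewrite expn0 !divn1 -!divb// eq_ca.
  by apply: eq_bigr => i _; rewrite eq_ca.
rewrite expnS !divnMA !divb//; rewrite IH//; split=> eq_ca i le_ji.
  have [k eq_i|eq_i] := unliftP ord0 i; last by rewrite eq_i in le_ji.
  by rewrite eq_i eq_ca//; move: le_ji; rewrite eq_i /= /bump leq0n add1n.
by apply: eq_ca; rewrite /= /bump leq0n add1n.
Qed.

(** By parity the two inequalities amount to [V < q.+1 * M] and [q * M <= V]. *)
Lemma eq_divn_interval (M V q : nat) : 0 < M ->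
  (V.*2 <= (q.+1 * M).*2.-1) && ((q * M).*2 <= V.*2.+1) = (V %/ M == q).
Proof.
move=> M_gt0; rewrite eqn_leq leq_divRL// -[V %/ M <= q]ltnS ltn_divLR//.
by apply/andP/andP; rewrite mulSn; lia.
Qed.

Lemma double_overlap (m n : nat) : m.*2 <= n.*2.+1 -> n.*2 <= m.*2.+1 -> m = n.
Proof. by lia. Qed.

(** * Lower bounds on functionality from separating pairs *)

Lemma vertex_fun_gt (G : sgraph) (k : nat) (y : G) :
  (forall s : seq G, size s <= k -> y \notin s -> exists z z',
    [/\ z != y /\ z' != y, adj y z && ~~ adj y z' &
        {in s, forall x, [&& z != x, ~~ adj z x, z' != x & ~~ adj z' x]}]) ->
  k < vertex_fun y.
Proof.
move=> sep; rewrite /vertex_fun; case: ex_minnP => m /existsP[x fx] _.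
rewrite ltnNge; apply/negP => le_mk; case/andP: fx => yNx /existsP[f /forallP fx].
have [||z [z' [[zy z'y] /andP[yz yz'] miss]]] := sep (tval x).
- by rewrite size_tuple.
- exact: yNx.
have zNx : z \notin x by apply/negP => /miss/and4P[]; rewrite eqxx.
have z'Nx : z' \notin x by apply/negP => /miss/and4P[_ _]; rewrite eqxx.
(* Both tuples are constantly false, so [f] takes the same value at [z] and [z'], which differ in
   adjacency to [y]. *)
have eq_map : map_tuple (adj z) x = map_tuple (adj z') x.
  by apply/val_inj/eq_in_map => w /miss/and4P[_ /negPf-> _ /negPf->].
have := fx z; have := fx z'; rewrite zy zNx z'y z'Nx /= yz (negPf yz') -eq_map.
by move=> /eqP<-.
Qed.

Lemma functionality_gt (G : sgraph) (k : nat) : 0 < #|G| ->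
  (forall (y : G) (s : seq G), size s <= k -> y \notin s -> exists z z',
    [/\ z != y /\ z' != y, adj y z && ~~ adj y z' &
        {in s, forall x, [&& z != x, ~~ adj z x, z' != x & ~~ adj z' x]}]) ->
  k < functionality G.
Proof.
move=> /card_gt0P[x0 _] sep.
have T0 : [set: G] != finset.set0 by apply/set0Pn; exists x0; rewrite inE.
(* The whole graph already serves as the induced subgraph. *)
rewrite /functionality (bigD1 [set: G])//= leq_max; apply/orP; left.
have gt_k (y : induced [set: G]) : k < vertex_fun y.
  apply: vertex_fun_gt => s sz yNs.
  have [||z [z' [[zy z'y] yzz' miss]]] := sep (val y) [seq val x | x <- s].
  - by rewrite size_map.
  - by rewrite mem_map//; exact: val_inj.
  exists (Sub z (finset.in_setT z)), (Sub z' (finset.in_setT z')); split=> //.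
  by move=> x xs; apply: (miss (val x)); apply: map_f.
(* The default value of the minimum exceeds [k] too, since it is larger than the functionality of
   any vertex. *)
rewrite /min_fun; elim/big_rec: _ => [|y m _ lt_km].
  exact: ltn_trans (gt_k (Sub x0 (finset.in_setT x0))) (vertex_fun_lt _).
by rewrite leq_min gt_k.
Qed.

(** Pigeonhole: if every index were hit, sending it to the position of the first element of [s]
    hitting it would inject [I] into ['I_(size s)]. *)
Lemma exists_missed (I : finType) (T : eqType) (P : T -> pred I) (s : seq T) :
  size s < #|I| -> {in s, forall x i j, P x i -> P x j -> i = j} ->
  exists i, {in s, forall x, ~~ P x i}.
Proof.
move=> lt_sI inj.
have [i /hasPn iP|all_hit] := pickP (fun i => ~~ has (P^~ i) s); first by exists i.
have hit i : has (P^~ i) s by have /negbFE := all_hit i.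
pose f i : 'I_(size s) := Ordinal (etrans (esym (has_find _ _)) (hit i)).
suff /leq_card : injective f by rewrite card_ord leqNgt lt_sI.
move=> i j /(congr1 val)/= eq_ij.
have [x0 _ _] := hasP (hit i).
apply: (inj (nth x0 s (find (P^~ i) s))); first by rewrite mem_nth -?has_find.
  exact: (nth_find x0 (hit i)).
by rewrite eq_ij; exact: (nth_find x0 (hit j)).
Qed.

(** * Points and axis-parallel lines of the grid *)

Section IncidenceGraph.
Variable N : nat.
Notation point := {ffun 'I_N.+2 -> 'I_N.+2}.
(* A line is a direction together with its point of zero coordinate there. *)
Notation line := {l : 'I_N.+2 * point | l.2 l.1 == ord0}.

Definition incident (c : point) (l : line) : bool :=
  [forall i, (i != (val l).1) ==> (c i == (val l).2 i)].

Lemma incidentP (c : point) (l : line) :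
  reflect (forall i, i != (val l).1 -> c i = (val l).2 i) (incident c l).
Proof.
by apply: (iffP 'forall_implyP) => cl i /cl => [/eqP|->].
Qed.

Definition incidence_adj : rel (point + line) := fun u v =>
  match u, v with
  | inl c, inr l | inr l, inl c => incident c l
  | _, _ => false
  end.

Lemma incidence_sym : symmetric incidence_adj.
Proof. by case=> [c|l] [c'|l']. Qed.

Lemma incidence_irrefl : irreflexive incidence_adj.
Proof. by case. Qed.

Definition incidence_graph : sgraph := SGraph incidence_sym incidence_irrefl.

Definition set_coord (c : point) (j t : 'I_N.+2) : point :=
  [ffun i => if i == j then t else c i].

Fact line_through_subproof (c : point) (j : 'I_N.+2) :
  (j, set_coord c j ord0).2 (j, set_coord c j ord0).1 == ord0.
Proof. by rewrite ffunE eqxx. Qed.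

Definition line_through (c : point) (j : 'I_N.+2) : line :=
  exist _ (j, set_coord c j ord0) (line_through_subproof c j).

Lemma incident_through (c c' : point) (j : 'I_N.+2) :
  reflect (forall i, i != j -> c i = c' i) (incident c (line_through c' j)).
Proof.
by apply: (iffP (incidentP _ _)) => /= eq_c i ij; rewrite eq_c// ffunE (negPf ij).
Qed.

(** The ways in which a listed vertex [x] disqualifies [z] as a member of a separating pair. *)
Definition hits (x z : incidence_graph) : bool := (z == x) || adj z x.

(** Diagonal points supply the non-neighbours. A line fixes some coordinate, because there are at
    least two directions, and that coordinate determines the diagonal point. *)
Lemma hits_diag_uniq (x : incidence_graph) (t u : 'I_N.+2) :
  hits x (inl [ffun=> t]) -> hits x (inl [ffun=> u]) -> t = u.
Proof.
case: x => [c|l]; rewrite /hits /= ?orbF.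
  by move=> /eqP[<-] /eqP[/ffunP/(_ ord0)]; rewrite !ffunE.
have off : lift (val l).1 ord0 != (val l).1 by rewrite eq_sym neq_lift.
by move=> /incidentP/(_ _ off) + /incidentP/(_ _ off); rewrite !ffunE => -> ->.
Qed.

(** Two lines through [c] in different directions share only [c]. *)
Lemma hits_through_uniq (c : point) (x : incidence_graph) (i j : 'I_N.+2) :
  x != inl c ->
  hits x (inr (line_through c i)) -> hits x (inr (line_through c j)) -> i = j.
Proof.
case: x => [c'|l]; rewrite /hits /= ?orbF.
  move=> neq_c /incident_through ci /incident_through cj.
  apply/eqP; apply: contraNT neq_c => neq_ij; apply/eqP; congr inl.
  apply/ffunP => h; have [eq_hi|] := eqVneq h i; last exact: ci.
  by apply: cj; rewrite eq_hi.
by move=> _ /eqP[<-] /eqP[].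
Qed.

(** A line in another direction fixes the coordinate that varies along [l]. A parallel line sharing
    a point with [l] is [l], as the base points are normalised. *)
Lemma hits_set_coord_uniq (l : line) (x : incidence_graph) (t u : 'I_N.+2) :
  let c v := set_coord (val l).2 (val l).1 v in
  x != inr l -> hits x (inl (c t)) -> hits x (inl (c u)) -> t = u.
Proof.
move=> c; case: x => [c'|l']; rewrite /hits /= ?orbF.
  by move=> _ /eqP[<-] /eqP[/ffunP/(_ (val l).1)]; rewrite !ffunE eqxx.
move=> neq_l /incidentP ct /incidentP cu.
have [eq_dir|neq_dir] := eqVneq (val l).1 (val l').1; last first.
  by move: (ct _ neq_dir) (cu _ neq_dir); rewrite !ffunE eqxx => -> ->.
case/eqP: neq_l; congr inr; apply: val_inj.
have [l0 l'0] := (eqP (valP l), eqP (valP l')).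
move: ct eq_dir l0 l'0; rewrite /c.
case: (val l) (val l') => [j a] [j' a'] /= ct eq_j aj a'j; subst j'.
congr (_, _); apply/ffunP => i; have [->|ij] := eqVneq i j; first by rewrite aj.
by rewrite -ct// ffunE (negPf ij).
Qed.

Lemma incidence_neighbour (y : incidence_graph) (s : seq incidence_graph) :
  size s < N.+2 -> y \notin s ->
  exists2 z, adj y z & {in s, forall x, ~~ hits x z}.
Proof.
move=> sz yNs; have neq_y x : x \in s -> x != y by apply: contraTneq => ->.
case: y yNs neq_y => [c|l] _ neq_y.
  have [|x xs i j|j jP] := @exists_missed _ _
      (fun x j => hits x (inr (line_through c j))) s.
  - by rewrite card_ord.
  - exact/hits_through_uniq/neq_y.
  exists (inr (line_through c j)) => //.
  exact/incident_through.
have [|x xs i j|t tP] := @exists_missed _ _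
    (fun x t => hits x (inl (set_coord (val l).2 (val l).1 t))) s.
- by rewrite card_ord.
- exact/hits_set_coord_uniq/neq_y.
exists (inl (set_coord (val l).2 (val l).1 t)) => //.
by apply/incidentP => i /negPf ij; rewrite ffunE ij.
Qed.

Lemma incidence_missed (s : seq incidence_graph) :
  size s < N.+2 -> exists z, {in s, forall x, ~~ hits x z}.
Proof.
move=> sz; have [|x _ i j|t tP] := @exists_missed _ _
    (fun x (t : 'I_N.+2) => hits x (inl [ffun=> t])) s.
- by rewrite card_ord.
- exact: hits_diag_uniq.
by exists (inl [ffun=> t]).
Qed.

Lemma incidence_functionality : N < functionality incidence_graph.
Proof.
apply: functionality_gt => [|y s sz yNs].
  by apply/card_gt0P; exists (inl [ffun=> ord0]).
have [z yz zP] := incidence_neighbour (leqW sz) yNs.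
(* Putting [y] in the list makes [z'] avoid [y] and its neighbours. The list now has up to [N.+1]
   entries, hence the side length [N.+2]. *)
have [z' z'P] := @incidence_missed (y :: s) sz.
have /norP[z'y yz'] := z'P y (mem_head _ _).
exists z, z'; split.
- by split=> //; apply: contraTneq yz => ->; rewrite adj_irrefl.
- by rewrite yz adj_sym.
move=> x xs; have /norP[-> ->] := zP x xs.
by have /norP[-> ->] : ~~ hits x z' by apply: z'P; rewrite inE xs orbT.
Qed.

(** * Integer corners of the boxes *)

Definition reading (c : point) : nat := radix N.+2 (fun i => c i).
Definition reversal (c : point) : point := [ffun i => c (rev_ord i)].
(** The exponent [j.+1] drops digit [j] too, which is free on a line in direction [j]. *)
Definition block (c : point) (j : 'I_N.+2) : nat := reading c %/ N.+2 ^ j.+1.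

Lemma block_eq (c a : point) (j : 'I_N.+2) :
  (block c j == block a j) = [forall i : 'I_N.+2, (j < i) ==> (c i == a i)].
Proof.
apply/eqP/'forall_implyP => [|eq_ca]; last first.
  by apply/radix_div_eq => // i ji; rewrite (eqP (eq_ca i ji)).
by move=> /radix_div_eq eq_ca i ji; apply/eqP/val_inj/eq_ca.
Qed.

(** Since [rev_ord] reverses the order, the digits above [rev_ord j] in the reversal are the
    original ones below [j]. *)
Lemma block_reversal_eq (c a : point) (j : 'I_N.+2) :
  (block (reversal c) (rev_ord j) == block (reversal a) (rev_ord j)) =
  [forall i : 'I_N.+2, (i < j) ==> (c i == a i)].
Proof.
have lt_rev (i h : 'I_N.+2) : (rev_ord i < rev_ord h) = (h < i).
  by have := ltn_ord i; have := ltn_ord h; rewrite /=; lia.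
rewrite block_eq; apply/'forall_implyP/'forall_implyP => eq_ca i.
  by rewrite -lt_rev => /eq_ca; rewrite !ffunE rev_ordK.
by rewrite -{1}(rev_ordK i) lt_rev !ffunE => /eq_ca.
Qed.

Lemma incident_blocks (c : point) (l : line) :
  let: (j, a) := val l in
  incident c l = (block c j == block a j) &&
    (block (reversal c) (rev_ord j) == block (reversal a) (rev_ord j)).
Proof.
rewrite /incident; case: (val l) => j a /=; rewrite block_eq block_reversal_eq.
apply/'forall_implyP/andP => [eq_ca|[/'forall_implyP gt_j /'forall_implyP lt_j] i].
  by split; apply/'forall_implyP => i lt; apply: eq_ca; rewrite neq_ltn lt ?orbT.
by rewrite neq_ltn => /orP[/lt_j|/gt_j].
Qed.

Lemma reading_inj : injective reading.
Proof.
move=> c a eq_ca; apply/ffunP => i; apply/val_inj.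
have [+ _] := @radix_div_eq N.+2 _ 0 (fun h => c h) (fun h => a h)
  (fun h => ltn_ord (c h)) (fun h => ltn_ord (a h)).
by apply=> //; rewrite -/(reading c) eq_ca.
Qed.

(* Readings are doubled so that a point [2V, 2V+1] and a block
   [2qM, 2(q+1)M-1] are solid intervals meeting exactly when V %/ M = q. *)
Definition block_lo (c : point) (j : 'I_N.+2) : nat :=
  (block c j * N.+2 ^ j.+1).*2.
Definition block_hi (c : point) (j : 'I_N.+2) : nat :=
  ((block c j).+1 * N.+2 ^ j.+1).*2.-1.

Lemma block_interval (c a : point) (j : 'I_N.+2) :
  ((reading c).*2 <= block_hi a j) && (block_lo a j <= (reading c).*2.+1) =
  (block c j == block a j).
Proof. by rewrite eq_divn_interval// expn_gt0. Qed.

(** Coordinate 2 is the height: the line of rank [r] occupies [[2r, 2r+1]], and each column runs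
    from 0 past all lines. *)
Definition corner_lo (v : incidence_graph) (i : 'I_3) : nat :=
  match v with
  | inl c => nth 0 [:: (reading c).*2; (reading (reversal c)).*2; 0] i
  | inr l => let: (j, a) := val l in
    nth 0 [:: block_lo a j; block_lo (reversal a) (rev_ord j); (enum_rank l).*2] i
  end.

Definition corner_hi (v : incidence_graph) (i : 'I_3) : nat :=
  match v with
  | inl c =>
    nth 0 [:: (reading c).*2.+1; (reading (reversal c)).*2.+1; #|{: line}|.*2.+1] i
  | inr l => let: (j, a) := val l in
    nth 0 [:: block_hi a j; block_hi (reversal a) (rev_ord j);
              (enum_rank l).*2.+1] i
  end.

Lemma block_lo_lt_hi (c : point) (j : 'I_N.+2) : block_lo c j < block_hi c j.
Proof.
rewrite /block_lo /block_hi mulSn.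
by have : 0 < N.+2 ^ j.+1 by [rewrite expn_gt0]; lia.
Qed.

Lemma corner_lo_lt_hi (v : incidence_graph) (i : 'I_3) :
  corner_lo v i < corner_hi v i.
Proof.
case: i => i lti; case: v => [c|l] /=; first by case: i lti => [|[|[|]]].
case: (val l) => j a; case: i lti => [|[|[|]]] //= _; exact: block_lo_lt_hi.
Qed.

Definition corners_meet (u v : incidence_graph) : bool :=
  [forall i, (corner_lo u i <= corner_hi v i) && (corner_lo v i <= corner_hi u i)].

Lemma corners_meetC (u v : incidence_graph) : corners_meet u v = corners_meet v u.
Proof. by apply: eq_forallb => i; rewrite andbC. Qed.

Lemma forall_ord3 (P : pred 'I_3) :
  [forall i, P i] = [&& P (inord 0), P (inord 1) & P (inord 2)].
Proof.
apply/forallP/and3P => [H|[H0 H1 H2] i]; first by split.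
by rewrite -(inord_val i); case: (nat_of_ord i) (ltn_ord i) => [|[|[|]]].
Qed.

Lemma corners_meet_incident (c : point) (l : line) :
  corners_meet (inl c) (inr l) = incident c l.
Proof.
have := incident_blocks c l; rewrite /corners_meet forall_ord3 /=.
case: (val l) => j a ->; rewrite !inordK//= !block_interval.
suff -> : (enum_rank l).*2 <= #|{: line}|.*2.+1 by rewrite andbT.
by apply: leqW; rewrite leq_double ltnW.
Qed.

Lemma corners_meet_points (c c' : point) :
  corners_meet (inl c) (inl c') -> c = c'.
Proof.
rewrite /corners_meet forall_ord3 /= !inordK//= => /and3P[/andP[le1 le2] _ _].
(* The first coordinate alone separates distinct points. *)
exact/reading_inj/double_overlap.
Qed.

Lemma corners_meet_lines (l l' : line) : corners_meet (inr l) (inr l') -> l = l'.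
Proof.
rewrite /corners_meet forall_ord3 /=; case: (val l) (val l') => j a [j' a'].
rewrite !inordK//= => /and3P[_ _ /andP[le1 le2]].
(* The heights alone separate distinct lines. *)
exact/enum_rank_inj/ord_inj/double_overlap.
Qed.

Lemma incidence_adjE (u v : incidence_graph) :
  u != v -> adj u v = corners_meet u v.
Proof.
case: u v => [c|l] [c'|l'] /= neq_uv.
- by apply/esym/negbTE; apply: contra neq_uv => /corners_meet_points->.
- by rewrite corners_meet_incident.
- by rewrite corners_meetC corners_meet_incident.
- by apply/esym/negbTE; apply: contra neq_uv => /corners_meet_lines->.
Qed.

End IncidenceGraph.

(** * From integer corners to real boxes *)

Local Open Scope classical_set_scope.
Local Open Scope ring_scope.

Definition nat_box (R : realType) (d : nat) (lo hi : 'I_d -> nat) : set 'rV[R]_d :=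
  [set x | forall i, x 0 i \in `[(lo i)%:R, (hi i)%:R]].
Arguments nat_box R {d} lo hi.

Lemma is_box_nat_box (R : realType) (d : nat) (lo hi : 'I_d -> nat) :
  (forall i, lo i < hi i)%N -> is_box (nat_box R lo hi).
Proof.
move=> lt_lohi; exists (\row_i (lo i)%:R), (\row_i (hi i)%:R); split=> [i|].
  by rewrite !mxE ltr_nat.
by apply/seteqP; split=> x /= xP i; have := xP i; rewrite !mxE.
Qed.

Lemma nat_box_meet (R : realType) (d : nat) (lo hi lo' hi' : 'I_d -> nat) :
  (forall i, lo i < hi i)%N -> (forall i, lo' i < hi' i)%N ->
  nat_box R lo hi `&` nat_box R lo' hi' !=set0 <->
  forall i, ((lo i <= hi' i) && (lo' i <= hi i))%N.
Proof.
move=> lt lt'; split=> [[x [xB xB']] i|meet].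
  move: (xB i) (xB' i); rewrite !in_itv /= => /andP[lox xhi] /andP[lox' xhi'].
  by rewrite -!(ler_nat R) (le_trans lox xhi') (le_trans lox' xhi).
(* In each coordinate the larger lower end lies in both intervals. *)
exists (\row_i (maxn (lo i) (lo' i))%:R).
split=> i; rewrite mxE in_itv /= !ler_nat; have /andP[] := meet i;
  rewrite geq_max leq_max leqnn ?orbT /= => le1 le2.
  by rewrite le2 ltnW.
by rewrite le1 ltnW.
Qed.

Lemma incidence_box_graph (R : realType) (N : nat) :
  box_graph R 3 (incidence_graph N).
Proof.
exists (fun v => nat_box R (corner_lo v) (corner_hi v)) => [v|u v neq_uv].
  exact/is_box_nat_box/corner_lo_lt_hi.
rewrite nat_box_meet; [|exact: corner_lo_lt_hi..].
by rewrite incidence_adjE//; split=> /forallP.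
Qed.

Theorem theorem4p4 (R : realType) (k : int) :
  exists G : sgraph, box_graph R 3 G /\ (k < (functionality G)%:Z)%R.
Proof.
exists (incidence_graph `|k|); split; first exact: incidence_box_graph.
apply: le_lt_trans (ler_norm k) _.
by rewrite -abszE ltz_nat; exact: incidence_functionality.
Qed.
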